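(* Let $F_n$ be the free group on $n \geq 2$ generators and let $Y$ be the space of coset partitions of $F_n$ with metric $\rho$. Let $P_0\in Y$ be represented by the coset partition $\{H_i\alpha_i\}_{i=1}^{s}$ with $[F_n:H_i]=d_i$ and $1<d_1 \leq \dots\leq d_s$. For $P\in Y$, let $\{K_j\beta_j\}_{j=1}^{t}$ denote a representative, with $e_j=[F_n:K_j]$ and $1<e_1\le\dots\le e_t$. (i) If there exists a $d_s$-cycle in the transition group $T_{H_s}$, then every $P \in Y$ with $\rho(P, P_0)< \frac{1}{2}$ satisfies the same condition (there exists an $e_t$-cycle in $T_{K_t}$) and hence has multiplicity. (ii) Let $2\le r\le s-1$ and suppose that either $r=2$ and $k(P_0)>d_{s-2}$, or $r=3$, $k(P_0)>d_{s-3}$ and $p(P_0)\ge 3$. Then every $P \in Y$ with $\rho(P, P_0)< 2^{-(r+1)}$ satisfies the same condition (respectively $k(P)>e_{t-2}$; or $k(P)>e_{t-3}$ and $p(P)\geq 3$) and hence has multiplicity. (iii) Let $2\le r\le s-1$ and suppose that there is $u\in F_n$ with $o_{max}(u)=k(P_0)$ such that, with $\#=|\{1\le i\le s\mid o_{*i}(u)=k(P_0)\}|\ge 2$, either $r=3$, $k(P_0)>d_{s-3}$, $p(P_0)=2$ and ($\#=2$ or $\#\ge 4$); or $r\ge 4$, $k(P_0)>d_{s-r}$ and ($p(P_0)\ge r$, or $\#=p(P_0)$, or $\#\ge r+1$). Then every $P \in Y$ with $\rho(P, P_0)< 2^{-(r+1)}$ has multiplicity.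
   Context: A coset partition of $F_n$ is a finite family $\{H_i\alpha_i\}_{i=1}^{s}$ of right cosets of subgroups $H_i$ ($\alpha_i\in F_n$) that are pairwise disjoint and whose union is $F_n$; it has multiplicity if $[F_n:H_i]=[F_n:H_j]$ for some $i\ne j$. $Y'$ is the set of all coset partitions of $F_n$ with all $H_i$ of finite index $d_i>1$, indexed so that $1<d_1\le\dots\le d_s$ (the indexing, including the order among equal indices, is part of the data). $P=\{H_i\alpha_i\}_{i=1}^{s}$ is identified with the tuple $(H_s,H_{s-1},\dots,H_1)$ ($H_s$ in first place, etc.). For $P,P'\in Y'$, $d(P,P')=2^{-k}$ if $k$ is the first place at which the tuples of $P$ and $P'$ differ, and $d(P,P')=0$ if the tuples coincide. $P\equiv P'$ iff $d(P,P')=0$; $Y=Y'/\!\equiv$ and $\rho$ is the metric on $Y$ induced by $d$. A class in $Y$ has multiplicity if its representatives do (this depends only on the tuple of subgroups). For $H<F_n$ of finite index $d$, the transition group $T_H$ is the image of $F_n$ in the symmetric group on the $d$ right cosets of $H$ under right multiplication; a $d$-cycle in it is a permutation that is a single cycle of length $d$. For a coset partition $Q=\{H_i\alpha_i\}_{i=1}^{s}$ and $w\in F_n$: $o_{*i}(w)$ is the least natural number $m\ge1$ with $w^m\in\alpha_i^{-1}H_i\alpha_i$; $o_{max}(w)=\max_{1\le i\le s}o_{*i}(w)$; $k(Q)=\max\{o_{max}(w)\mid w\in F_n\}$, which equals the maximal length of a cycle (in disjoint cycle decompositions) of a permutation in $\bigcup_{i}T_{H_i}$ (so depends only on the tuple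 of subgroups); $p(Q)$ is the smallest prime dividing $k(Q)$. *)

(* Defs.v *)
From HB Require Import structures.
From mathcomp Require Import all_boot all_order all_algebra all_fingroup finmap.
From mathcomp Require Import boolp classical_sets cardinality reals.
From mathcomp Require Import topology_structure uniform_structure.
From mathcomp Require Import pseudometric_structure metric_structure.

Set Implicit Arguments.
Unset Strict Implicit.
Unset Printing Implicit Defensive.

Import Order.TTheory GRing.Theory Num.Theory.
Local Open Scope classical_set_scope.
Local Open Scope quotient_scope.

(* The free group of rank n, as the set of reduced words in the letters x_i
   (encoded (i, true)) and x_i^-1 (encoded (i, false)). *)

Section ReducedWords.
Variable n : nat.
Notation letter := ('I_n * bool)%type.
Implicit Types (a b : letter) (u v w : seq letter).

Definition invl a : letter := (a.1, ~~ a.2).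
Definition reduced w := sorted (fun a b => b != invl a) w.

(* reduced form of a :: w, for w reduced *)
Definition consr a w :=
  if w is b :: w' then if b == invl a then w' else a :: w else [:: a].

Lemma invlK : involutive invl.
Proof. by case=> i b; rewrite /invl /= negbK. Qed.

Lemma reduced_consr a w : reduced w -> reduced (consr a w).
Proof.
case: w => [//|b w] /= rw; case: ifP => [_|ab]; first exact: path_sorted rw.
by rewrite /= ab.
Qed.

Lemma consrK a w : reduced w -> consr (invl a) (consr a w) = w.
Proof.
case: w => [|b w] rw; first by rewrite /consr invlK eqxx.
rewrite {2}/consr; case: (b =P invl a) rw => [->|_ _]; last by rewrite /consr invlK eqxx.
by case: w => [//|c w] /= /andP[/negPf-> _].
Qed.

Definition mulw u v := foldr consr v u.

Lemma reduced_mulw u v : reduced v -> reduced (mulw u v).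
Proof. by move=> rv; elim: u => //= a u; apply: reduced_consr. Qed.

Lemma mulw_consr a u v : reduced u -> reduced v ->
  mulw (consr a u) v = consr a (mulw u v).
Proof.
case: u => [//|b u] ru rv /=; case: (b =P invl a) => [->|//].
by have := consrK (invl a) (reduced_mulw u rv); rewrite invlK => ->.
Qed.

Lemma mulwA u v w : reduced v -> reduced w ->
  mulw u (mulw v w) = mulw (mulw u v) w.
Proof.
move=> rv rw; elim: u => //= a u ->.
by rewrite mulw_consr // reduced_mulw.
Qed.

Lemma mulw0 u : reduced u -> mulw u [::] = u.
Proof.
elim: u => //= a u IHu rau; rewrite IHu; last exact: path_sorted rau.
by case: u rau {IHu} => //= b u /andP[/negPf->].
Qed.

Definition invw w := rev (map invl w).

Lemma reduced_invw w : reduced w -> reduced (invw w).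
Proof.
rewrite /invw /reduced rev_sorted sorted_map; apply: sub_sorted => a b /=.
by rewrite invlK eq_sym.
Qed.

Lemma mulVw w v : reduced v -> mulw (invw w) (mulw w v) = v.
Proof.
elim: w v => [//|a w IHw] v rv.
rewrite /invw /= rev_cons /mulw -cats1 foldr_cat /=.
by rewrite consrK ?reduced_mulw //; apply: IHw.
Qed.

Lemma invwK : involutive invw.
Proof. by move=> w; rewrite /invw map_rev revK (mapK invlK). Qed.

End ReducedWords.

Definition free_group (n : nat) := {w : seq ('I_n * bool) | reduced w}.
HB.instance Definition _ n := Choice.on (free_group n).

Section FreeGroup.
Variable n : nat.
Implicit Types u v w : free_group n.

Definition fg_mul u v : free_group n :=
  exist _ (mulw (val u) (val v)) (reduced_mulw (val u) (valP v)).
Definition fg_one : free_group n := exist _ [::] isT.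
Definition fg_inv u : free_group n :=
  exist _ (invw (val u)) (reduced_invw (valP u)).

Lemma fg_mulA : associative fg_mul.
Proof. by move=> u v w; apply: val_inj; apply: mulwA; apply: valP. Qed.
Lemma fg_mul1 : left_id fg_one fg_mul.
Proof. by move=> u; apply: val_inj. Qed.
Lemma fg_mulr1 : right_id fg_one fg_mul.
Proof. by move=> u; apply: val_inj; apply: mulw0; apply: valP. Qed.
Lemma fg_mulV : left_inverse fg_one fg_inv fg_mul.
Proof.
move=> u; apply: val_inj => /=.
by rewrite -{2}(mulw0 (valP u)) mulVw.
Qed.
Lemma fg_mulrV : right_inverse fg_one fg_inv fg_mul.
Proof.
move=> u; rewrite -{1}(_ : fg_inv (fg_inv u) = u) ?fg_mulV //.
by apply: val_inj; apply: invwK.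
Qed.

End FreeGroup.

HB.instance Definition _ n := isGroup.Build (free_group n)
  (@fg_mulA n) (@fg_mul1 n) (@fg_mulr1 n) (@fg_mulV n) (@fg_mulrV n).

Definition least (A : set nat) : nat :=
  xget 0%N [set m | A m /\ forall j, A j -> (m <= j)%N].
Definition greatest (A : set nat) : nat :=
  xget 0%N [set m | A m /\ forall j, A j -> (j <= m)%N].

Lemma leastP (A : set nat) : A !=set0 ->
  A (least A) /\ forall j, A j -> (least A <= j)%N.
Proof.
case=> m Am; rewrite /least; case: xgetP => [_ _ //|H]; exfalso.
have exA : exists i, `[< A i >] by exists m; apply/asboolP.
case: (ex_minnP exA) => k /asboolP Ak kmin.
by apply: (H k); split => // j /asboolP; apply: kmin.
Qed.

Lemma greatestP (A : set nat) (N : nat) : A !=set0 ->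
  (forall j, A j -> (j <= N)%N) ->
  A (greatest A) /\ forall j, A j -> (j <= greatest A)%N.
Proof.
case=> m Am AN; rewrite /greatest; case: xgetP => [_ _ //|H]; exfalso.
have exA : exists i, `[< A i >] by exists m; apply/asboolP.
have bA : forall i, `[< A i >] -> (i <= N)%N by move=> i /asboolP; apply: AN.
case: (ex_maxnP exA bA) => k /asboolP Ak kmax.
by apply: (H k); split => // j /asboolP; apply: kmax.
Qed.

Lemma in_fset_set_finite (T : choiceType) (A : set T) (x : T) :
  x \in fset_set A -> finite_set A /\ A x.
Proof.
have [fA|nfA] := pselect (finite_set A); first by rewrite in_fset_set // inE.
by rewrite /fset_set; case: pselect.
Qed.

Section Cosets.
Variable G : groupType.
Implicit Types (H : set G) (a w : G).

Definition subgroup H :=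
  H 1%g /\ forall x y, H x -> H y -> H (x * y^-1)%g.

Definition right_coset H a : set G := [set (h * a)%g | h in H].

Definition right_cosets H : set (set G) := range (right_coset H).

(* This is 0 when the index is infinite. *)
Definition group_index H : nat := #|` fset_set (right_cosets H)|.

(* For H of finite index, the finite type of the right cosets of H. *)
Notation cosets H := (fset_set (right_cosets H)).

Lemma right_cosetM H a w : right_coset (right_coset H a) w = right_coset H (a * w)%g.
Proof.
by rewrite /right_coset image_comp; apply: eq_imagel => h _ /=; rewrite mulgA.
Qed.

Lemma right_coset1 H : right_coset H 1%g = H.
Proof.
by rewrite /right_coset -[RHS]image_id; apply: eq_imagel => h _; rewrite mulg1.
Qed.

Lemma right_coset_in H w (C : cosets H) : right_coset (val C) w \in cosets H.
Proof.
have [fH [a _ <-]] := in_fset_set_finite (valP C).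
rewrite in_fset_set // right_cosetM; apply/mem_set.
by exists (a * w)%g.
Qed.

Definition coset_mul H w (C : cosets H) : cosets H := [` right_coset_in w C]%fset.

Lemma coset_mul_inj H w : injective (coset_mul (H := H) w).
Proof.
apply: (can_inj (g := coset_mul (H := H) w^-1)) => C; apply: val_inj => /=.
by rewrite right_cosetM mulgV right_coset1.
Qed.

Definition coset_perm H w : {perm cosets H} := perm (@coset_mul_inj H w).

Lemma coset_permM H v w :
  coset_perm H (v * w)%g = (coset_perm H v * coset_perm H w)%g.
Proof.
by apply/permP => C; apply: val_inj; rewrite permM !permE /= right_cosetM.
Qed.

Definition transition_group H : set {perm cosets H} := range (coset_perm H).

(* o_{*i}(w), for H = H_i and a = alpha_i; [h ^ a] is a^-1 h a. *)
Definition ostar H a w : nat :=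
  least [set m | (0 < m)%N /\ [set (h ^ a)%g | h in H] (w ^+ m)%g].

Lemma ostar_bounded H a : subgroup H -> finite_set (right_cosets H) ->
  exists N, forall w,
    [/\ (0 < ostar H a w <= N)%N,
        [set (h ^ a)%g | h in H] (w ^+ ostar H a w)%g &
        forall m, (0 < m)%N -> [set (h ^ a)%g | h in H] (w ^+ m)%g ->
          (ostar H a w <= m)%N].
Proof.
move=> [H1 HV] fH; exists #|{: {perm cosets H}}| => w.
set A := [set m | (0 < m)%N /\ [set (h ^ a)%g | h in H] (w ^+ m)%g].
have permX m : coset_perm H (w ^+ m)%g = (coset_perm H w ^+ m)%g.
  elim: m => [|m IHm]; last by rewrite !expgS coset_permM IHm.
  by apply/permP => C; apply: val_inj; rewrite !permE /= right_coset1.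
have Ao : A #[coset_perm H w]%g.
  split; first exact: order_gt0.
  have aH : right_coset H a \in cosets H.
    by rewrite in_fset_set //; apply/mem_set; exists a.
  have /permP/(_ [` aH]%fset)/(congr1 val) := permX #[coset_perm H w]%g.
  rewrite expg_order !permE /= right_cosetM => E.
  have : right_coset H a (a * w ^+ #[coset_perm H w]%g)%g.
    by rewrite -E; exists 1%g; rewrite ?mul1g.
  by case=> h Hh Eh; exists h => //; rewrite conjgE Eh mulKg.
have [[o0 Ho] omin] : A (ostar H a w) /\ forall j, A j -> (ostar H a w <= j)%N.
  by apply: leastP; exists #[coset_perm H w]%g.
split=> //; last by move=> m m0 Hm; apply: omin.
by rewrite o0 (leq_trans (omin _ Ao)) // max_card.
Qed.

End Cosets.

Notation cosets H := (fset_set (right_cosets H)).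
Arguments coset_perm {G} H w.
Arguments transition_group {G} H _.

Definition is_cycle (T : finType) (d : nat) (s : {perm T}) :=
  exists x, #|porbit s x| = d /\ perm_on (porbit s x) s.

(* A family (H_i alpha_i)_{1 <= i <= s} is the sequence of the pairs
   (H_i, alpha_i); the accessors below use indices starting at 1. *)

Section Families.
Variable G : groupType.
Implicit Type Q : seq (set G * G).

Definition subgrp Q i : set G := (nth (setT, 1%g) Q i.-1).1.
Definition repr_of Q i : G := (nth (setT, 1%g) Q i.-1).2.
Definition idx Q i : nat := group_index (subgrp Q i).

Definition is_coset_partition Q :=
  [/\ forall i, (1 <= i <= size Q)%N -> subgroup (subgrp Q i),
      forall i j, (1 <= i <= size Q)%N -> (1 <= j <= size Q)%N -> i <> j ->
        right_coset (subgrp Q i) (repr_of Q i) `&` right_coset (subgrp Q j) (repr_of Q j)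
        = set0 &
      \bigcup_(i in [set i | (1 <= i <= size Q)%N])
        right_coset (subgrp Q i) (repr_of Q i) = setT].

Definition has_multiplicity Q :=
  exists i j, [/\ (1 <= i <= size Q)%N, (1 <= j <= size Q)%N, i <> j &
    idx Q i = idx Q j].

(* Indices > 1 are finite by the convention on group_index; finiteness is
   nevertheless stated. *)
Definition indexed_partition Q :=
  [/\ is_coset_partition Q,
      forall i, (1 <= i <= size Q)%N ->
        finite_set (right_cosets (subgrp Q i)) /\ (1 < idx Q i)%N &
      forall i j, (1 <= i)%N -> (i <= j)%N -> (j <= size Q)%N ->
        (idx Q i <= idx Q j)%N].

Definition ostar_at Q i (w : G) : nat := ostar (subgrp Q i) (repr_of Q i) w.

Definition omax Q (w : G) : nat :=
  \max_(1 <= i < (size Q).+1) ostar_at Q i w.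

Definition kmax Q : nat := greatest (range (omax Q)).

Definition pmin Q : nat := pdiv (kmax Q).

(* The number # of indices at which o_{*i}(w) reaches k(Q). *)
Definition num_max Q (w : G) : nat :=
  count (fun i => ostar_at Q i w == kmax Q) (iota 1 (size Q)).

Lemma kmaxP Q : indexed_partition Q ->
  (exists w, omax Q w = kmax Q) /\ forall w, (omax Q w <= kmax Q)%N.
Proof.
case=> -[Qsub _ _] Qfin _.
have [N QN] : exists N, forall i w, (1 <= i <= size Q)%N ->
    (ostar_at Q i w <= N)%N.
  have H i : exists N, (1 <= i <= size Q)%N -> forall w, (ostar_at Q i w <= N)%N.
    have [iQ|] := pselect (1 <= i <= size Q)%N; last by exists 0%N.
    have [N HN] := ostar_bounded (repr_of Q i) (Qsub i iQ) (Qfin i iQ).1.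
    by exists N => _ w; have [/andP[]] := HN w.
  have [f fP] := choice H.
  exists (\max_(1 <= i < (size Q).+1) f i) => i w iQ.
  apply: leq_trans (fP i iQ w) _.
  by apply: (@leq_bigmax_seq _ _ xpredT) => //; rewrite mem_index_iota.
have [||[w _ wk] kub] := @greatestP (range (omax Q)) N.
- by exists (omax Q 1%g); exists 1%g.
- move=> _ [w _ <-]; apply/bigmax_leqP_seq => i.
  by rewrite mem_index_iota ltnS => iQ _; apply: QN.
by split; [exists w | move=> v; apply: kub; exists v].
Qed.

Definition subgroup_tuple Q : seq (set G) := rev (map fst Q).

End Families.

Definition coset_partition (n : nat) :=
  {Q : seq (set (free_group n) * free_group n) | `[< indexed_partition Q >]}.
HB.instance Definition _ n := Choice.on (coset_partition n).

Definition parts n (P : coset_partition n) :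
  seq (set (free_group n) * free_group n) := val P.

(* First place, counted from 1, at which two sequences differ; a place lying
   beyond the end of exactly one of them counts as a difference. *)
Definition first_diff (T : Type) (t t' : seq T) : nat :=
  least [set k | (0 < k)%N /\ onth t k.-1 <> onth t' k.-1].

Section Space.
Variables (R : realType) (n : nat).
Local Open Scope ring_scope.
Implicit Types P Q S : coset_partition n.

Definition dist P Q : R :=
  let t := subgroup_tuple (parts P) in let t' := subgroup_tuple (parts Q) in
  if t == t' then 0 else 2 ^- first_diff t t'.

Lemma first_diffP (T : eqType) (t t' : seq T) : t != t' ->
  [/\ (0 < first_diff t t')%N,
      onth t (first_diff t t').-1 <> onth t' (first_diff t t').-1 &
      forall k, (0 < k)%N -> onth t k.-1 <> onth t' k.-1 ->
        (first_diff t t' <= k)%N].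
Proof.
move=> tt'; have [|[H1 H2] H3] := @leastP
    [set k | (0 < k)%N /\ onth t k.-1 <> onth t' k.-1].
  apply: contrapT => H; move/eqP: tt'; apply; apply: eq_from_onth => i.
  by apply: contrapT => ne; apply: H; exists i.+1.
by split=> // k k0 kd; apply: H3.
Qed.

Lemma dist_eq0 P Q :
  (dist P Q == 0) = (subgroup_tuple (parts P) == subgroup_tuple (parts Q)).
Proof.
rewrite /dist; case: ifP => [_|_]; first by rewrite eqxx.
by rewrite invr_eq0 expf_eq0 pnatr_eq0 andbF.
Qed.

Lemma dist_ge0 P Q : 0 <= dist P Q.
Proof. by rewrite /dist; case: ifP => // _; rewrite invr_ge0 exprn_ge0. Qed.

Lemma dist_sym P Q : dist P Q = dist Q P.
Proof.
rewrite /dist eq_sym; case: ifP => // _; congr (2 ^- least _).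
by apply/seteqP; split=> k [k0 kd]; split=> // E; apply: kd.
Qed.

Lemma dist_triangle Q P S : dist P S <= dist P Q + dist Q S.
Proof.
have [->|ne] := eqVneq (dist P S) 0; first by rewrite addr_ge0 ?dist_ge0.
move: ne; rewrite dist_eq0 => ne; have [k0 kd _] := first_diffP ne.
have le U V : onth (subgroup_tuple (parts U)) (first_diff (subgroup_tuple (parts P))
      (subgroup_tuple (parts S))).-1 <>
    onth (subgroup_tuple (parts V)) (first_diff (subgroup_tuple (parts P))
      (subgroup_tuple (parts S))).-1 -> dist P S <= dist U V.
  move=> d; have neUV : subgroup_tuple (parts U) != subgroup_tuple (parts V).
    by apply/eqP => E; apply: d; rewrite E.
  rewrite /dist (negPf ne) (negPf neUV) lef_pV2 ?posrE ?exprn_gt0 //.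
  by rewrite ler_eXn2l ?ltr1n //; have [_ _] := first_diffP neUV; apply.
have [E|d] := pselect (onth (subgroup_tuple (parts P)) (first_diff
   (subgroup_tuple (parts P)) (subgroup_tuple (parts S))).-1 =
   onth (subgroup_tuple (parts Q)) (first_diff
   (subgroup_tuple (parts P)) (subgroup_tuple (parts S))).-1).
  by rewrite (le_trans (le Q S _)) ?lerDr ?dist_ge0 // -E.
by rewrite (le_trans (le P Q d)) ?lerDl ?dist_ge0.
Qed.

Definition dist0 P Q : bool := dist P Q == 0.

Lemma dist0_equiv : equiv_class_of dist0.
Proof.
split=> [P|P Q|Q P S]; rewrite /dist0.
- by rewrite dist_eq0 eqxx.
- by rewrite dist_sym.
- by rewrite !dist_eq0 => /eqP-> /eqP->.
Qed.

Canonical dist0_equiv_rel := EquivRelPack dist0_equiv.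

Definition partition_space := {eq_quot dist0_equiv_rel}.
HB.instance Definition _ := EqQuotient.on partition_space.
HB.instance Definition _ := Choice.on partition_space.

Definition rho (x y : partition_space) : R := dist (generic_quotient.repr x) (generic_quotient.repr y).

Lemma rho_pi P Q : rho (\pi P) (\pi Q) = dist P Q.
Proof.
have E S : subgroup_tuple (parts (generic_quotient.repr (\pi_partition_space S))) =
    subgroup_tuple (parts S).
  by apply/eqP; rewrite -dist_eq0; have /eqmodP := reprK (\pi_partition_space S).
by rewrite /rho /dist !E.
Qed.

Lemma rhoxx x : rho x x = 0.
Proof. by apply/eqP; rewrite dist_eq0. Qed.
Lemma rho_positivity x y : rho x y = 0 -> x = y.
Proof. by move=> /eqP d0; rewrite -[x]reprK -[y]reprK; apply/eqmodP. Qed.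
Lemma rho_sym x y : rho x y = rho y x.
Proof. exact: dist_sym. Qed.
Lemma rho_triangle y x z : rho x z <= rho x y + rho y z.
Proof. exact: dist_triangle. Qed.

HB.instance Definition _ := isMetric.Build R partition_space
  rhoxx rho_positivity rho_sym rho_triangle.

End Space.

Section Conditions.
Variable G : groupType.
Implicit Type Q : seq (set G * G).

Definition top_cycle Q :=
  exists2 g, transition_group (subgrp Q (size Q)) g & is_cycle (idx Q (size Q)) g.

(* The condition 2 <= r <= s - 1 makes size Q - r a genuine index. *)
Definition kmax_condition (r : nat) Q :=
  (2 <= r <= size Q - 1)%N /\
  ((r = 2 /\ (idx Q (size Q - 2) < kmax Q)%N) \/
   [/\ r = 3, (idx Q (size Q - 3) < kmax Q)%N & (3 <= pmin Q)%N]).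

End Conditions.

(* Main.v *)
(* For fixed g and w, the sets {m | g w^m in H_i alpha_i} partition the integers
   into residue classes, of modulus o_{*i}(w) when nonempty.  In such a partition
   with largest modulus k > 1, at least p classes have modulus k, where p is the
   smallest prime divisor of k.  Indeed, average over the translates by k, then
   apply the product over the primes q | k of the difference operators of step
   k/q: the classes of modulus other than k are killed, and fewer than p classes
   of modulus k cannot be.  Hence, if at most p cosets reach o_max(w) = k, every
   orbit of w meeting one of them meets them all; each meets such an orbit with
   density 1/k, so they have equal density and their subgroups equal index.
   Conjugating w shows that k(P) only depends on the subgroups, and k > d_{s-r}
   confines the cosets involved to the last r ones, which P shares with P_0. *)
Require Import Defs.
From mathcomp Require Import all_boot all_order all_algebra all_fingroup finmap.
From mathcomp Require Import boolp classical_sets cardinality reals.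
From mathcomp Require Import topology_structure uniform_structure.
From mathcomp Require Import pseudometric_structure metric_structure.
From mathcomp Require Import zify.
Import Order.TTheory GRing.Theory Num.Theory.
Local Open Scope classical_set_scope.
Local Open Scope quotient_scope.
Local Open Scope ring_scope.

Set Implicit Arguments.
Unset Strict Implicit.
Unset Printing Implicit Defensive.

(** * Difference operators and periodicity *)

Section Differences.
Implicit Types (f : nat -> int) (c d e k m x : nat) (ds : seq nat).

Definition difference d f m := f m - f (m + d)%N.
Definition differences ds f := foldr difference f ds.

Definition periodic d f := forall m, f (m + d)%N = f m.

Lemma differences_sum (I : finType) (P : pred I) (f : I -> nat -> int) ds m :
  differences ds (fun x => \sum_(i | P i) f i x) m =
  \sum_(i | P i) differences ds (f i) m.
Proof. by elim: ds m => // d ds IH m; rewrite /= /difference !IH -sumrB. Qed.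

Lemma periodic_differences ds d f : periodic d f -> periodic d (differences ds f).
Proof. by move=> pf; elim: ds => //= e ds IH m; rewrite /difference addnAC !IH. Qed.

Lemma differences_periodic0 ds d f m :
  d \in ds -> periodic d f -> differences ds f m = 0.
Proof.
move=> + pf; elim: ds m => //= e ds IH m; rewrite inE => /orP[/eqP<-|dds].
  by rewrite /difference (periodic_differences ds pf) subrr.
by rewrite /difference !IH // subrr.
Qed.

(** Steps divisible by [d] never leave the residue class of [x] modulo [d]. *)
Lemma differences_local ds d f x :
    (forall e, e \in ds -> (d %| e)%N) ->
    (forall y, (y = x %[mod d])%N -> f y = 0) ->
  differences ds f x = 0.
Proof.
elim: ds x => [|e ds IH] x dds fx /=; first exact: fx.
have {}IH y : (y = x %[mod d])%N -> differences ds f y = 0.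
  move=> yx; apply: IH => [e' e'ds|z]; first by apply: dds; rewrite inE e'ds orbT.
  by rewrite yx; apply: fx.
have /dvdnP[q ->] : (d %| e)%N by apply: dds; rewrite mem_head.
by rewrite /difference !IH // ?subrr // addnC modnMDl.
Qed.

Lemma periodicM d f j : periodic d f -> periodic (j * d)%N f.
Proof.
by move=> pf; elim: j => [|j IH] m; rewrite ?mul0n ?addn0 // mulSn addnA IH pf.
Qed.

Lemma periodic_dvd d e f : (d %| e)%N -> periodic d f -> periodic e f.
Proof. by case/dvdnP=> j -> /periodicM; apply. Qed.

Lemma periodic_gcd d e f :
  (0 < d)%N -> periodic d f -> periodic e f -> periodic (gcdn d e) f.
Proof.
(* Bezout with natural coefficients: [u * d = v * e + gcdn d e]. *)
move=> d0 pd pe m; have [u v E _] := egcdnP e d0.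
by rewrite -(periodicM v pe) -addnA [(_ + v * e)%N]addnC -E (periodicM u pd).
Qed.

Lemma dvdn_divn_prime k q r :
  prime q -> prime r -> q != r -> (r %| k)%N -> (0 < k)%N ->
  (q ^ logn q k %| k %/ r)%N.
Proof.
move=> pq pr qr rk k0; rewrite -(@Gauss_dvdl _ _ r).
  by rewrite divnK // pfactor_dvdnn.
by rewrite coprimeXl // prime_coprime // dvdn_prime2.
Qed.

(** [k %/ q] contains one factor [q] less than [k], so a congruence modulo the full [q]-part of [k]
    forces [q] to divide [j' - j], which is smaller than [q]. *)
Lemma pfactor_Mdivn_inj k q (x : nat) (j j' : 'I_q) :
  prime q -> (q %| k)%N -> (0 < k)%N ->
  (x + j * (k %/ q) = x + j' * (k %/ q) %[mod q ^ logn q k])%N -> j = j'.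
Proof.
move=> pq qk k0.
wlog jj' : j j' / (j <= j')%N => [W E|].
  by case/orP: (leq_total j j') => le; [apply: W | symmetry; apply: W].
move/eqP; rewrite eq_sym eqn_mod_dvd; last by rewrite leq_add2l leq_mul2r jj' orbT.
rewrite subnDl -mulnBl -(@dvdn_pmul2r q) ?prime_gt0 // -mulnA divnK //.
have [e qe kE] := pfactor_coprime pq k0.
rewrite {2}kE [(_ * q)%N]mulnC mulnA dvdn_pmul2r ?expn_gt0 ?prime_gt0 //.
rewrite Gauss_dvdl // => qd.
apply: val_inj; apply/eqP; rewrite /= eqn_leq jj' -subn_eq0 -leqn0 leqNgt.
apply/negP => /dvdn_leq/(_ qd); rewrite leqNgt.
by rewrite (leq_ltn_trans (leq_subr _ _) (ltn_ord j')).
Qed.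

(* The sets of points congruent modulo [q ^ logn q k] are stable under all
   shifts by [k %/ r] with [r != q], while the shifts by [k %/ q] cycle through
   [q] of them, one of which avoids the support. *)
Lemma differences_small_support (I : finType) (J : pred I) (c : I -> nat)
    (k : nat) (qs : seq nat) f :
    (0 < k)%N -> uniq qs -> {subset qs <= primes k} -> (#|J| < pdiv k)%N ->
    (forall m, f m != 0 -> exists2 i, i \in J & (m = c i %[mod k])%N) ->
    (forall m, differences [seq (k %/ q)%N | q <- qs] f m = 0) ->
  forall m, f m = 0.
Proof.
move=> k0 + + Jk fJ; elim: qs => [//|q qs IH] /= /andP[qqs uqs] qsk df0.
have prs r : r \in q :: qs -> prime r /\ (r %| k)%N.
  by move/qsk; rewrite mem_primes => /and3P[].
have [pq qk] := prs q (mem_head _ _).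
apply: IH => // [r rqs|x]; first by apply: qsk; rewrite inE rqs orbT.
set g := differences _ f; set M := (q ^ logn q k)%N.
(* The operator of step [k %/ q] kills [g], so [g x] may be computed at any translate of [x] by a
   multiple of [k %/ q]. *)
have gper : periodic (k %/ q)%N g.
  by move=> m; apply/eqP; rewrite eq_sym -subr_eq0; apply/eqP; apply: df0.
(* Pigeonhole: otherwise each of the [q] translates meets the class of some [i] in [J], different
   translates need different [i], and [q <= #|J| < pdiv k <= q]. *)
have [j jJ] : exists j : 'I_q, forall i, i \in J ->
    (x + j * (k %/ q) <> c i %[mod M])%N.
  apply: contrapT => noj.
  have /choice[a aP] (j : 'I_q) : exists i, i \in J /\ (x + j * (k %/ q) = c i %[mod M])%N.
    apply: contrapT => noi; apply: noj; exists j => i iJ E; apply: noi.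
    by exists i.
  have inja : injective a.
    move=> j j' ajj'; apply: (pfactor_Mdivn_inj (k := k) (x := x)) => //.
    by rewrite (aP j).2 ajj' (aP j').2.
  have := leq_trans Jk (pdiv_min_dvd (prime_gt1 pq) qk); rewrite ltnNge.
  have -> // : (q <= #|J|)%N.
  rewrite -[q in (q <= _)%N]card_ord -(card_imset _ inja).
  by apply/subset_leq_card/fintype.subsetP => _ /imsetP[j _ ->]; case: (aP j).
rewrite -(periodicM j gper); apply: (@differences_local _ M).
  move=> _ /mapP[r rqs ->]; have [|pr rk] := prs r; first by rewrite inE rqs orbT.
  by apply: dvdn_divn_prime => //; apply: contraNneq qqs => ->.
move=> y yx; apply/eqP/negPn/negP => /fJ[i iJ yc]; apply: (jJ i iJ).
by rewrite -yx -[LHS](modn_dvdm y (pfactor_dvdnn q k)) yc modn_dvdm ?pfactor_dvdnn.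
Qed.

End Differences.

(** * Partitions of the natural numbers into residue classes *)

Section DisjointCovers.
Variables (I : finType) (o : I -> nat) (h : I -> nat -> bool) (k : nat).
Hypothesis k_gt1 : (1 < k)%N.
Hypothesis o_bound : forall i, (0 < o i <= k)%N.
Hypothesis h_periodic : forall i m, h i (m + o i)%N = h i m.
Hypothesis h_cover : forall m, (\sum_i h i m)%N = 1%N.
Hypothesis h_class :
  forall i m m', o i = k -> h i m -> h i m' -> (m = m' %[mod k])%N.

(* Averaging over the translates by multiples of [k] makes [h i] periodic of
   period [gcdn (o i) k], a proper divisor of [k] unless [o i = k]. *)
Let avg i m : int := \sum_(t < (\prod_j o j)%N) (h i (m + t * k)%N)%:Z.

Let avg_periodic_k i : periodic k (avg i).
Proof.
move=> m; rewrite /avg; set L := (\prod_j o j)%N.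
have L0 : (0 < L)%N by rewrite prodn_gt0 // => j; case/andP: (o_bound j).
have oL : (o i %| L)%N by rewrite /L (bigD1 i) //= dvdn_mulr.
(* Shifting by [k] trades the term [t = 0] for [t = L]; they agree because [o i] divides [L]. *)
rewrite -(prednK L0) big_ord_recr [RHS]big_ord_recl /= addrC; congr (_ + _).
  have -> : (m + k + L.-1 * k = m + (k * (L %/ o i)) * o i)%N.
    by rewrite -mulnA divnK // -addnA -mulSn prednK // mulnC.
  have hM j x : h i (x + j * o i)%N = h i x.
    by elim: j x => [|j IH] x; rewrite ?addn0 // mulSn addnA IH h_periodic.
  by rewrite hM mul0n addn0.
by apply: eq_bigr => t _; rewrite /bump /= add1n mulSn addnA.
Qed.

Let avg_periodic_o i : periodic (o i) (avg i).
Proof. by move=> m; apply: eq_bigr => t _; rewrite addnAC h_periodic. Qed.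

Let sum_avg m : \sum_i avg i m = (\prod_j o j)%N%:Z.
Proof.
rewrite exchange_big /= (eq_bigr (fun=> 1)) => [|t _].
  by rewrite sumr_const card_ord natz.
by rewrite -(big_morph Posz PoszD (erefl (Posz 0))) h_cover.
Qed.

Let top_class m : \sum_(i | o i == k) avg i m != 0 ->
  exists2 i, o i == k & exists t, h i (m + t * k)%N.
Proof.
move=> nz; apply: contrapT => H; move/eqP: nz; apply.
apply: big1 => i oik; apply: big1 => t _.
by case E: (h i _) => //; exfalso; apply: H; exists i => //; exists t.
Qed.

(** The sum of all averages is constant, hence killed. For [o i <> k] the period [gcdn (o i) k]
    properly divides [k], hence divides [k %/ q] for some prime [q], and the factor of step [k %/ q]
    kills [avg i]. Only the classes of modulus [k] remain. *)
Let differences_top m :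
  differences [seq (k %/ q)%N | q <- primes k] (fun x => \sum_(i | o i == k) avg i x) m = 0.
Proof.
set ds := map _ _; have pdk : (k %/ pdiv k)%N \in ds.
  by rewrite map_f // mem_primes pdiv_prime // (ltnW k_gt1) pdiv_dvd.
have : differences ds (fun x => \sum_i avg i x) m = 0.
  by apply: (differences_periodic0 _ pdk) => x; rewrite !sum_avg.
rewrite differences_sum (bigID (fun i => o i == k)) /= [X in _ + X]big1 => [|i oik].
  by rewrite addr0 differences_sum.
have [o0 ok] := andP (o_bound i); have k0 := ltnW k_gt1.
have gk : (1 < k %/ gcdn (o i) k)%N.
  rewrite ltn_divRL ?dvdn_gcdr // mul1n (leq_ltn_trans (dvdn_leq o0 (dvdn_gcdl _ _))) //.
  by rewrite ltn_neqAle oik.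
set q := pdiv (k %/ gcdn (o i) k).
have gq : (q * gcdn (o i) k %| k)%N by rewrite -dvdn_divRL ?dvdn_gcdr ?pdiv_dvd.
have pq : prime q by apply: pdiv_prime.
have qk : (q %| k)%N := dvdn_trans (dvdn_mulr _ (dvdnn q)) gq.
apply: (@differences_periodic0 _ (k %/ q)%N).
  by rewrite map_f // mem_primes pq k0.
apply: periodic_dvd (periodic_gcd o0 (avg_periodic_o i) (avg_periodic_k i)).
by rewrite dvdn_divRL // mulnC.
Qed.

Lemma pdiv_leq_card_top_classes i0 m0 : o i0 = k -> h i0 m0 ->
  (pdiv k <= #|[pred i | (o i == k) && `[< exists m, h i m >]]|)%N.
Proof.
move=> oi0 hi0; rewrite leqNgt; apply/negP => small.
have /choice[c cP] i : exists c, (exists m, h i m) -> h i c.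
  by have [[m hm]|H] := pselect (exists m, h i m); [exists m | exists 0%N].
have k0 := ltnW k_gt1.
have supp m : \sum_(i | o i == k) avg i m != 0 ->
    exists2 i, i \in [pred i | (o i == k) && `[< exists m, h i m >]] &
      (m = c i %[mod k])%N.
  move=> /top_class[i /eqP oik [t hit]]; exists i.
    by rewrite inE oik eqxx; apply/asboolP; exists (m + t * k)%N.
  rewrite -(modnMDl t) addnC; apply: (h_class oik hit).
  by apply: cP; exists (m + t * k)%N.
(* The sum over the classes of modulus [k] would vanish everywhere; but at [m0] the class of [i0]
   contributes the positive number [\prod_j o j], and the others are nonnegative. *)
have := differences_small_support k0 (primes_uniq k) (fun _ => id) small supp
  differences_top m0.
rewrite (bigD1 i0) /= ?oi0 //.
have -> : avg i0 m0 = \sum_(t < (\prod_j o j)%N) 1.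
  apply: eq_bigr => t _; suff -> : h i0 (m0 + t * k)%N by [].
  by rewrite -oi0; elim: (val t) => [|u IH]; rewrite ?addn0 // mulSnr addnA h_periodic.
rewrite sumr_const card_ord => H.
have : (0 : int) < 1 *+ (\prod_j o j)%N + \sum_(i | (o i == k) && (i != i0)) avg i m0.
  rewrite ltr_wpDr ?sumr_ge0 // => [i _|]; first by apply: sumr_ge0.
  by rewrite pmulrn_lgt0 // prodn_gt0 // => j; case/andP: (o_bound j).
by rewrite H ltxx.
Qed.

End DisjointCovers.

(** * Powers of an element acting on the cosets of one subgroup *)

Section Ostar.
Variables (G : groupType) (H : set G) (a w : G).
Hypothesis sgH : subgroup H.
Hypothesis fH : finite_set (right_cosets H).

Lemma subgroupV x : H x -> H (x^-1)%g.
Proof. by case: sgH => H1 HV Hx; rewrite -[(x^-1)%g]mul1g; apply: HV. Qed.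

Lemma subgroupM x y : H x -> H y -> H (x * y)%g.
Proof. by case: sgH => H1 HV Hx /subgroupV Hy; rewrite -[y]invgK; apply: HV. Qed.

Lemma right_cosetP x b : right_coset H b x <-> H (x * b^-1)%g.
Proof.
split=> [[h Hh <-]|Hx]; first by rewrite mulgK.
by exists (x * b^-1)%g; rewrite ?mulgVK.
Qed.

Lemma eq_right_coset x b : right_coset H b x -> right_coset H x = right_coset H b.
Proof.
move=> /right_cosetP Hxb; apply/seteqP; split=> y /right_cosetP Hy; apply/right_cosetP.
  by have := subgroupM Hy Hxb; rewrite mulgA mulgVK.
by have := subgroupM Hy (subgroupV Hxb); rewrite invgM invgK mulgA mulgVK.
Qed.

Let v := (w ^ a^-1)%g.

Lemma conj_subgroupP x : [set (h ^ a)%g | h in H] x <-> H (x ^ a^-1)%g.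
Proof.
split=> [[h Hh <-]|Hx]; first by rewrite conjgK.
by exists (x ^ a^-1)%g => //; rewrite conjgKV.
Qed.

(** The remainder of an admissible exponent modulo the least one is admissible, hence 0 by
    minimality. *)
Lemma ostarP : (0 < ostar H a w)%N /\ forall m, H (v ^+ m)%g <-> (ostar H a w %| m)%N.
Proof.
have [N HN] := ostar_bounded a sgH fH; have [/andP[o0 _] ow omin] := HN w.
have vo : H (v ^+ ostar H a w)%g by rewrite -conjXg; apply/conj_subgroupP.
have vM j : H (v ^+ (j * ostar H a w))%g.
  elim: j => [|j IH]; first by case: sgH.
  by rewrite mulSn expgnDr; apply: subgroupM.
split=> // m; split=> [vm|/dvdnP[j ->] //].
apply/negPn/negP => nd.
have r0 : (0 < m %% ostar H a w)%N by rewrite lt0n.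
have /omin : [set (h ^ a)%g | h in H] (w ^+ (m %% ostar H a w))%g.
  apply/conj_subgroupP; rewrite conjXg.
  have := subgroupM (subgroupV (vM (m %/ ostar H a w)%N)) vm.
  by rewrite {2}(divn_eq m (ostar H a w)) expgnDr mulKg.
by move/(_ r0); rewrite leqNgt ltn_mod o0.
Qed.

Lemma right_coset_ostar x :
  right_coset H a (x * w ^+ ostar H a w)%g <-> right_coset H a x.
Proof.
have [_ /(_ (ostar H a w))] := ostarP; rewrite dvdnn => -[_ /(_ isT) Hv].
have E : (x * w ^+ ostar H a w * a^-1 = (x * a^-1) * v ^+ ostar H a w)%g.
  by rewrite -conjXg conjgE invgK !mulgA mulgVK.
split=> /right_cosetP Hx; apply/right_cosetP; last by rewrite E; apply: subgroupM.
by rewrite E in Hx; have := subgroupM Hx (subgroupV Hv); rewrite mulgK.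
Qed.

Lemma right_coset_mod x m m' :
  right_coset H a (x * w ^+ m)%g -> right_coset H a (x * w ^+ m')%g ->
  (m = m' %[mod ostar H a w])%N.
Proof.
wlog mm' : m m' / (m <= m')%N => [W Hm Hm'|].
  by case/orP: (leq_total m m') => le; [apply: W | symmetry; apply: W].
have E j : (x * w ^+ j * a^-1 = (x * a^-1) * v ^+ j)%g.
  by rewrite -conjXg conjgE invgK !mulgA mulgVK.
move=> /right_cosetP + /right_cosetP; rewrite !E => Hm Hm'.
apply/eqP; rewrite eq_sym eqn_mod_dvd //; apply/ostarP.2.
have := subgroupM (subgroupV Hm) Hm'.
by rewrite -[in X in H X -> _](subnKC mm') expgnDr (mulgA (x * _)%g) mulKg.
Qed.

Lemma coset_ofP g : right_coset H g \in cosets H.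
Proof. by rewrite in_fset_set //; apply/mem_set; exists g. Qed.

Lemma card_cosets : #|{: cosets H}| = group_index H.
Proof. by rewrite /group_index cardfE. Qed.

(** The cosets of [a * w ^+ j] for [j < ostar H a w] are pairwise distinct. *)
Lemma ostar_leq_index : (ostar H a w <= group_index H)%N.
Proof.
rewrite -card_cosets -[leqLHS]card_ord.
apply: (@leq_card _ _ (fun j : 'I_(ostar H a w) => [` coset_ofP (a * w ^+ j)%g]%fset)).
move=> j j'; wlog jj' : j j' / (j <= j')%N => [W E|].
  by case/orP: (leq_total j j') => le; [apply: W | symmetry; apply: W].
move=> /(congr1 val) /= E; apply/val_inj/eqP; rewrite /= eqn_leq jj' -subn_eq0.
have H1 : H 1%g by case: sgH.
have [h Hh] : right_coset H (a * w ^+ j)%g (a * w ^+ j')%g.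
  by rewrite E; exists 1%g; rewrite ?mul1g.
rewrite -(subnK jj') expgnDr !mulgA => /mulIg ha.
rewrite -(modn_small (leq_ltn_trans (leq_subr j j') (ltn_ord j'))).
have -> : ((j' - j) %% ostar H a w = 0 %% ostar H a w)%N; last by rewrite mod0n addnK.
apply: (@right_coset_mod a); first by rewrite -ha; exists h.
by rewrite mulg1; exists 1%g; rewrite ?mul1g.
Qed.
End Ostar.

(** * Comparing the indices of two subgroups by double counting *)

Section Indices.
Variable G : groupType.
Implicit Types (H K : set G) (a b g w : G).

(** A change of coset representative is absorbed by conjugating [w], so the set of values over all
    [w] depends on [H] only. *)
Lemma ostar_conjg H a b w : ostar H b (w ^ (a^-1 * b))%g = ostar H a w.
Proof.
rewrite /ostar; congr least; apply/seteqP; split=> m [m0 /conj_subgroupP Hm];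
  by split=> //; apply/conj_subgroupP; move: Hm; rewrite -conjXg -conjgM mulgK.
Qed.

(** [act (a1^-1 * a2)] injects the fiber over [H a1] into the one over [H a2], so all fibers have
    the same size. *)
Lemma card_fiber H (T : finType) (X : pred T) (act : G -> T -> T)
    (pi : T -> cosets H) (C : cosets H) :
    (forall g, injective (act g)) -> (forall g x, X x -> X (act g x)) ->
    (forall g x, pi (act g x) = Defs.coset_mul g (pi x)) ->
  #|X| = (group_index H * #|[pred x | X x && (pi x == C)]|)%N.
Proof.
move=> act_inj actX pi_act.
have le C1 C2 : (#|[pred x | X x && (pi x == C1)]| <=
                 #|[pred x | X x && (pi x == C2)]|)%N.
  have [_ [a1 _ a1E]] := in_fset_set_finite (valP C1).
  have [_ [a2 _ a2E]] := in_fset_set_finite (valP C2).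
  rewrite -(card_imset _ (act_inj (a1^-1 * a2)%g)).
  apply/subset_leq_card/fintype.subsetP => _ /imsetP[x /andP[Xx /eqP piC] ->].
  rewrite inE actX //= pi_act piC; apply/eqP/val_inj.
  by rewrite /= -a1E -a2E right_cosetM mulKVg.
rewrite -sum1_card (partition_big pi predT) //=.
rewrite (eq_bigr (fun=> #|[pred x | X x && (pi x == C)]|)) => [|C' _].
  by rewrite sum_nat_const card_cosets.
transitivity #|[pred x | X x && (pi x == C')]|; first by rewrite -sum1_card.
by apply/eqP; rewrite eqn_leq; apply/andP; split; apply: le.
Qed.

(* On the orbit of [(H, K)] in [cosets H * cosets K], translation along the
   cycles of [w] injects the fiber over [H a] into the fiber over [K b]. *)
Lemma leq_group_index H K a b w :
    subgroup H -> finite_set (right_cosets H) ->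
    subgroup K -> finite_set (right_cosets K) ->
    ostar H a w = ostar K b w ->
    (forall x, right_coset H a x -> exists m, right_coset K b (x * w ^+ m)%g) ->
  (group_index K <= group_index H)%N.
Proof.
move=> sH fH sK fK oE hit; set k := ostar H a w in oE.
pose cH g : cosets H := [` coset_ofP fH g]%fset.
pose cK g : cosets K := [` coset_ofP fK g]%fset.
pose X := [pred x : cosets H * cosets K | `[< exists g, x = (cH g, cK g) >]].
pose act g (x : cosets H * cosets K) := (Defs.coset_mul g x.1, Defs.coset_mul g x.2).
have cHM g g' : Defs.coset_mul g (cH g') = cH (g' * g)%g.
  by apply: val_inj; rewrite /= right_cosetM.
have cKM g g' : Defs.coset_mul g (cK g') = cK (g' * g)%g.
  by apply: val_inj; rewrite /= right_cosetM.
have act_inj g : injective (act g).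
  by move=> [x1 x2] [y1 y2] [E1 E2]; congr pair;
    by apply/(@coset_mul_inj _ _ g)/val_inj.
have actX g x : X x -> X (act g x).
  move=> /asboolP[g' ->]; apply/asboolP; exists (g' * g)%g.
  by rewrite /act /= cHM cKM.
have EH := card_fiber (pi := fst) (cH a) act_inj actX (fun _ _ => erefl).
have EK := card_fiber (pi := snd) (cK b) act_inj actX (fun _ _ => erefl).
set XH := [pred x | X x && (x.1 == cH a)] in EH.
set XK := [pred x | X x && (x.2 == cK b)] in EK.
have [k0 _] := ostarP a w sH fH.
have XHK : (#|XH| <= #|XK|)%N.
  have /choice[f fP] (x : cosets H * cosets K) : exists m, XH x ->
      (m < k)%N /\ exists g, [/\ x = (cH g, cK g), right_coset H a g &
        right_coset K b (g * w ^+ m)%g].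
    have [XHx|] := pselect (is_true (XH x)); last by exists 0%N.
    have /andP[/asboolP[g xE] /eqP x1] := XHx.
    have Hg : right_coset H a g.
      rewrite xE in x1; move/(congr1 val): x1 => /= <-.
      by exists 1%g; [case: sH | rewrite mul1g].
    (* [K b] is stable under [w ^+ k] in both directions, so the exponent can be reduced modulo [k];
       the bound then turns congruent exponents into equal ones. *)
    have [m Km] := hit g Hg; exists (m %% k)%N => _; split; first by rewrite ltn_mod.
    exists g; split=> //.
    have Ko y := right_coset_ostar b w sK fK y; rewrite -oE in Ko.
    have wM j y : right_coset K b (y * w ^+ (j * k))%g -> right_coset K b y.
      elim: j => [|j IH]; first by rewrite mulg1.
      by rewrite mulSnr expgnDr mulgA => /Ko/IH.
    by apply: (wM (m %/ k)%N); rewrite -mulgA -expgnDr addnC -divn_eq.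
  have F_inj : {in XH &, injective (fun x => act (w ^+ f x)%g x)}.
    move=> x y /fP[fx [g [xE Hg _]]] /fP[fy [g' [yE Hg' _]]] E.
    suff fxy : f x = f y by move: E; rewrite fxy => /act_inj.
    have E1 : Defs.coset_mul (w ^+ f x)%g x.1 = Defs.coset_mul (w ^+ f y)%g y.1.
      by have := congr1 fst E.
    move: E1; rewrite (congr1 fst xE : x.1 = cH g) (congr1 fst yE : y.1 = cH g').
    rewrite !cHM => /(congr1 val) /= Ew.
    have [h Hh hE] : right_coset H (g' * w ^+ f y)%g (g * w ^+ f x)%g.
      by rewrite -Ew; exists 1%g; [case: sH | rewrite mul1g].
    have Hhg : right_coset H a (h * g')%g.
      apply/right_cosetP; rewrite -mulgA; apply: (subgroupM sH) => //.
      exact/right_cosetP.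
    rewrite -(modn_small fx) -(modn_small fy).
    (* From this base point the exponent [f y] leads to [g] and [f x] leads to [h * g'], both in
       [H a]. *)
    apply: (right_coset_mod sH fH (x := (g * w ^- f y)%g)); last by rewrite mulgVK.
    have -> // : (g * w ^- f y * w ^+ f x = h * g')%g.
    have cw : commute (w ^- f y)%g (w ^+ f x)%g.
      by apply/commute_sym/commuteV/commuteX2.
    by rewrite -mulgA cw mulgA -hE mulgA mulgK.
  rewrite -(card_in_imset F_inj).
  apply/subset_leq_card/fintype.subsetP => _ /imsetP[x /[dup] /andP[Xx _] /fP[_ [g [xE _ Kg]]] ->].
  rewrite inE actX //= (congr1 snd xE : x.2 = cK g) cKM; apply/eqP/val_inj => /=.
  exact: eq_right_coset.
have XH0 : (0 < #|XH|)%N.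
  by apply/card_gt0P; exists (cH a, cK a); rewrite !inE eqxx andbT; apply/asboolP; exists a.
(* Both products of index and fiber size equal [#|X|], so the larger fiber belongs to the smaller
   index. *)
by rewrite -(leq_pmul2r XH0) -EH EK leq_mul2l XHK orbT.
Qed.

End Indices.

(** * Parts of a coset partition at which the maximal modulus is reached *)

Lemma count_iota1 (P : pred nat) s : count P (iota 1 s) = #|[pred j : 'I_s | P j.+1]|.
Proof.
rewrite -[X in iota X]addn0 iotaDl count_map -val_enum_ord count_map.
by rewrite cardE size_filter enumT; apply: eq_count => j; rewrite /= add1n.
Qed.

Section Partitions.
Variables (G : groupType) (Q : seq (set G * G)).
Hypothesis partQ : Defs.indexed_partition Q.
Implicit Types (i j : nat) (w x : G).

Local Notation part i := (right_coset (subgrp Q i) (Defs.repr_of Q i)).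
Local Notation in_range i := (1 <= i <= size Q)%N.

Let subgroupQ i : in_range i -> subgroup (subgrp Q i).
Proof. by case: partQ => -[sQ _ _] _ _; apply: sQ. Qed.

Let finQ i : in_range i -> finite_set (right_cosets (subgrp Q i)).
Proof. by case: partQ => _ fQ _ /fQ[]. Qed.

Lemma size_partition_gt0 : (0 < size Q)%N.
Proof.
case: partQ => -[_ _ covQ] _ _.
have [i /= /andP[i0 iQ] _] : (\bigcup_(i in [set i | in_range i]) part i) 1%g.
  by rewrite covQ.
exact: leq_trans iQ.
Qed.

Lemma idx_gt1 i : in_range i -> (1 < idx Q i)%N.
Proof. by case: partQ => _ fQ _ /fQ[]. Qed.

Lemma ostar_at_leq_idx i w : in_range i -> (ostar_at Q i w <= idx Q i)%N.
Proof. by move=> iQ; apply: ostar_leq_index; [apply: subgroupQ | apply: finQ]. Qed.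

Lemma ostar_at_leq_omax i w : in_range i -> (ostar_at Q i w <= omax Q w)%N.
Proof.
move=> iQ; apply: (@leq_bigmax_seq _ _ xpredT (fun i => ostar_at Q i w)) => //.
by rewrite mem_index_iota.
Qed.

Lemma omax_attained w : exists2 i, in_range i & ostar_at Q i w = omax Q w.
Proof.
rewrite /omax big_add1 /= big_mkord.
have [|i E] := @bigop.eq_bigmax _ (fun i : 'I_(size Q) => ostar_at Q i.+1 w).
  by rewrite card_ord size_partition_gt0.
by exists i.+1; rewrite ?ltn_ord //.
Qed.

(** Along [m |-> x * w ^+ m] the parts cut the natural numbers into residue classes, and the class
    of part [i] contains 0. Ordinals start at 0 and parts at 1, hence [j.+1] and [i.-1]. *)
Lemma pdiv_leq_card_orbit i w x : (1 < omax Q w)%N -> in_range i ->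
    ostar_at Q i w = omax Q w -> part i x ->
  (pdiv (omax Q w) <= #|[pred j : 'I_(size Q) | (ostar_at Q j.+1 w == omax Q w) &&
     `[< exists m, part j.+1 (x * w ^+ m)%g >]]|)%N.
Proof.
move=> k1 /[dup] iQ /andP[i0 iQ'] oi xi.
have ip : (i.-1 < size Q)%N by rewrite prednK.
have [[_ disjQ covQ] _ _] := partQ.
pose h (j : 'I_(size Q)) m := `[< part j.+1 (x * w ^+ m)%g >].
have rng (j : 'I_(size Q)) : in_range j.+1 by rewrite ltn_ord.
have := @pdiv_leq_card_top_classes _ (fun j : 'I_(size Q) => ostar_at Q j.+1 w) h
  (omax Q w) k1 _ _ _ _ (Ordinal ip) 0.
rewrite /= prednK // => H; apply: leq_trans (H _ _ _ _ oi _) _.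
- move=> j; rewrite ostar_at_leq_omax // andbT.
  by have [] := ostarP (Defs.repr_of Q j.+1) w (subgroupQ (rng j)) (finQ (rng j)).
- move=> j m; apply: asbool_equiv_eq; rewrite expgnDr mulgA.
  exact: right_coset_ostar (subgroupQ (rng j)) (finQ (rng j)) _.
- move=> m; have : (\bigcup_(i in [set i | in_range i]) part i) (x * w ^+ m)%g.
    by rewrite covQ.
  move=> [j /= /andP[j0 jQ] xj]; have jp : (j.-1 < size Q)%N by rewrite prednK.
  rewrite (bigD1 (Ordinal jp)) //= big1 => [|j' j'j].
    by rewrite /h /= prednK //; case: asboolP.
  rewrite /h; case: asboolP => // xj'; exfalso.
  have jj' : j'.+1 <> j by move=> E; move/eqP: j'j; apply; apply: val_inj; rewrite /= -E.
  have /seteqP[/(_ (x * w ^+ m)%g) dj _] := disjQ _ _ (rng j') (introT andP (conj j0 jQ)) jj'.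
  exact: dj.
- move=> j m m' oj /asboolP hm /asboolP hm'; rewrite -[omax Q w]oj.
  exact: (right_coset_mod (subgroupQ (rng j)) (finQ (rng j)) hm hm').
- by rewrite /h /= prednK //; apply/asboolP; rewrite mulg1.
- apply/subset_leq_card/fintype.subsetP => j /andP[/= oj /asboolP[m /asboolP xm]].
  by rewrite inE oj; apply/asboolP; exists m.
Qed.

Lemma num_max_card w : num_max Q w = #|[pred j : 'I_(size Q) | ostar_at Q j.+1 w == kmax Q]|.
Proof. exact: count_iota1. Qed.

Lemma repr_in_part i : in_range i -> part i (Defs.repr_of Q i).
Proof. by move=> /subgroupQ[H1 _]; exists 1%g; rewrite ?mul1g. Qed.

Section TopParts.
Variable w : G.
Hypothesis wk : omax Q w = kmax Q.
Hypothesis k1 : (1 < kmax Q)%N.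

Lemma pmin_leq_num_max : (pmin Q <= num_max Q w)%N.
Proof.
have [i iQ oi] := omax_attained w.
rewrite /pmin -wk; apply: leq_trans (pdiv_leq_card_orbit _ iQ oi (repr_in_part iQ)) _.
  by rewrite wk.
rewrite num_max_card wk.
by apply/subset_leq_card/fintype.subsetP => j /andP[].
Qed.

Lemma two_top_parts : exists i j, [/\ in_range i, in_range j, i <> j,
  ostar_at Q i w = kmax Q & ostar_at Q j w = kmax Q].
Proof.
have : (1 < num_max Q w)%N.
  by apply: leq_trans pmin_leq_num_max; rewrite prime_gt1 ?pdiv_prime.
rewrite num_max_card => /card_gt1P[i [j [/eqP oi /eqP oj ij]]].
exists i.+1, j.+1; split; rewrite ?ltn_ord //.
by move=> [] /val_inj E; rewrite E eqxx in ij.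
Qed.

(** Every orbit of [w] through part [i] meets at least [pmin Q] parts reaching the maximum, hence
    all of them, part [j] included. *)
Lemma leq_idx_top_parts i j : (num_max Q w <= pmin Q)%N ->
  in_range i -> in_range j -> ostar_at Q i w = kmax Q -> ostar_at Q j w = kmax Q ->
  (idx Q j <= idx Q i)%N.
Proof.
move=> small iQ jQ oi oj.
apply: (@leq_group_index _ _ _ (Defs.repr_of Q i) (Defs.repr_of Q j) w (subgroupQ iQ) (finQ iQ)
  (subgroupQ jQ) (finQ jQ)).
  exact: etrans oi (esym oj).
move=> x xi; have k1' : (1 < omax Q w)%N by rewrite wk.
have := pdiv_leq_card_orbit k1' iQ (etrans oi (esym wk)) xi.
set A := [pred _ | _]; set B := [pred j : 'I_(size Q) | ostar_at Q j.+1 w == kmax Q].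
have AB : A \subset B by apply/fintype.subsetP => l; rewrite !inE wk => /andP[].
rewrite wk => pA; have [j0 jQ'] := andP jQ.
have jp : (j.-1 < size Q)%N by rewrite prednK.
have /subset_cardP/(_ AB)/(_ (Ordinal jp)) : #|A| = #|B|.
  apply/eqP; rewrite eqn_leq subset_leq_card //=; apply: leq_trans pA.
  by rewrite -num_max_card.
rewrite !inE /= prednK // wk oj eqxx /= => /asboolP[m xm].
by exists m.
Qed.

Lemma equal_idx_top_parts : (num_max Q w <= pmin Q)%N ->
  exists i j, [/\ in_range i, in_range j, i <> j & idx Q i = idx Q j] /\
    ostar_at Q i w = kmax Q /\ ostar_at Q j w = kmax Q.
Proof.
have [i [j [iQ jQ ij oi oj]]] := two_top_parts => small.
exists i, j; do !split => //; apply/eqP; rewrite eqn_leq.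
by rewrite !leq_idx_top_parts.
Qed.

End TopParts.

(** [ostar_at Q i w] is at most [idx Q i], and the indices increase with [i]. *)
Lemma top_parts_last r i w : (r < size Q)%N -> in_range i ->
  (idx Q (size Q - r) < ostar_at Q i w)%N -> (size Q - r < i)%N.
Proof.
move=> rQ iQ; have [_ _ idx_mono] := partQ; have [i0 iQ'] := andP iQ.
rewrite !ltnNge; apply: contra => ir.
apply: leq_trans (ostar_at_leq_idx w iQ) _.
by apply: idx_mono; rewrite ?leq_subr.
Qed.

Lemma num_max_leq r w : (r < size Q)%N -> (idx Q (size Q - r) < kmax Q)%N ->
  (num_max Q w <= r)%N.
Proof.
move=> rQ rk; rewrite /num_max -[X in iota _ X](subnK (ltnW rQ)) iotaD count_cat.
rewrite (eq_in_count (a2 := pred0)) ?count_pred0 => [|i].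
  by rewrite (leq_trans (count_size _ _)) ?size_iota.
rewrite mem_iota => /andP[i0 ir]; apply/negP => /eqP oi.
have /(top_parts_last (r := r)(w := w)) H : in_range i.
  by rewrite i0 (leq_trans _ (leq_subr r (size Q))) // -ltnS -add1n.
by move: ir; rewrite add1n ltnS leqNgt H // oi.
Qed.

End Partitions.

(** All cosets form one orbit of [w], so [H a] cannot return to itself before visiting each of
    them. *)
Lemma ostar_is_cycle (G : groupType) (H : set G) (a w : G) :
  subgroup H -> finite_set (right_cosets H) ->
  is_cycle (group_index H) (coset_perm H w) -> ostar H a w = group_index H.
Proof.
move=> sH fH [C [Cd _]]; apply/eqP; rewrite eqn_leq ostar_leq_index //=.
set s := coset_perm H w in Cd; pose C0 : cosets H := [` coset_ofP fH a]%fset.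
have CC0 : C0 \in porbit s C.
  have /subset_cardP/(_ (subset_predT _)) -> // : #|porbit s C| = #|{: cosets H}|.
  by rewrite Cd card_cosets.
have sE m : val (iter m s C0) = right_coset H (a * w ^+ m)%g.
  elim: m => [|m IH]; first by rewrite /= mulg1.
  by rewrite iterS permE /= IH right_cosetM -mulgA -expgSr.
have so : iter (ostar H a w) s C0 = C0.
  apply: val_inj; rewrite sE; apply: (eq_right_coset sH).
  by apply/(right_coset_ostar _ _ sH fH); exists 1%g; [case: sH | rewrite mul1g].
have [o0 _] := ostarP a w sH fH; rewrite leqNgt; apply/negP => od.
have := uniq_traject_porbit s C0.
move: CC0; rewrite -eq_porbit_mem => /eqP ->; rewrite Cd => U.
have := nth_uniq C0 _ _ U (i := 0) (j := ostar H a w).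
rewrite size_traject => /(_ (leq_ltn_trans (leq0n _) od) od).
by rewrite !nth_traject ?(leq_ltn_trans _ od) // so eqxx => /esym/eqP E; rewrite -E in o0.
Qed.

(** * Partitions sharing their last subgroups *)

Section Neighbours.
Variable G : groupType.
Implicit Type Q : seq (set G * G).

Lemma onth_subgroup_tuple Q j : (j < size Q)%N ->
  onth (subgroup_tuple Q) j = Some (subgrp Q (size Q - j)).
Proof.
move=> jQ; have lt : (size Q - j.+1 < size Q)%N by lia.
rewrite onthE (nth_map setT) ?size_rev ?size_map // nth_rev ?size_map //.
by rewrite (nth_map (setT, 1%g)) // /subgrp subnS.
Qed.

(** The range [j <= r] covers [r + 1] subgroups: the last [r], where the maximum is reached, and the
    one whose index is compared with [kmax]. *)
Definition same_last r Q Q' :=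
  forall j, (j <= r)%N -> subgrp Q (size Q - j) = subgrp Q' (size Q' - j).

Lemma kmax_leq_same_last r Q Q' :
    Defs.indexed_partition Q -> Defs.indexed_partition Q' ->
    (r < size Q)%N -> (r < size Q')%N -> same_last r Q Q' ->
  (idx Q (size Q - r) < kmax Q)%N -> (kmax Q <= kmax Q')%N.
Proof.
move=> pQ pQ' rQ rQ' same rk; have [[w wk] _] := kmaxP pQ.
have [i iQ oi] := omax_attained pQ w.
have ri : (size Q - r < i)%N.
  by apply: (top_parts_last (w := w) pQ rQ iQ); rewrite oi wk.
have [i0 iQ'] := andP iQ.
have sE := same (size Q - i)%N; rewrite subKn // in sE.
have jQ' : (1 <= size Q' - (size Q - i) <= size Q')%N by lia.
(* The shared subgroup may carry another representative in [Q']; this conjugate of [w] compensates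
   for it. *)
pose v := (w ^ ((Defs.repr_of Q i)^-1 * Defs.repr_of Q' (size Q' - (size Q - i))))%g.
rewrite -wk -oi.
have -> : ostar_at Q i w = ostar_at Q' (size Q' - (size Q - i)) v.
  by rewrite /ostar_at -sE ?ostar_conjg //; lia.
exact: leq_trans (ostar_at_leq_omax _ jQ') ((kmaxP pQ').2 v).
Qed.

Lemma kmax_same_last r Q Q' :
    Defs.indexed_partition Q -> Defs.indexed_partition Q' ->
    (r < size Q)%N -> (r < size Q')%N -> same_last r Q Q' ->
  (idx Q (size Q - r) < kmax Q)%N -> kmax Q' = kmax Q.
Proof.
move=> pQ pQ' rQ rQ' same rk; apply/eqP; rewrite eqn_leq.
have le := kmax_leq_same_last pQ pQ' rQ rQ' same rk; rewrite le andbT.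
(* The first inequality supplies the index condition on [Q'] required for the reverse one. *)
apply: (kmax_leq_same_last pQ' pQ rQ' rQ) => [j jr|]; first by rewrite same.
by rewrite /idx -same //; apply: leq_trans rk le.
Qed.

Lemma multiplicity_same_last r Q Q' w :
    Defs.indexed_partition Q -> (r < size Q)%N -> (r < size Q')%N ->
    same_last r Q Q' -> (idx Q (size Q - r) < kmax Q)%N ->
    omax Q w = kmax Q -> (num_max Q w <= pmin Q)%N ->
  has_multiplicity Q'.
Proof.
move=> pQ rQ rQ' same rk wk small.
have k1 : (1 < kmax Q)%N.
  by apply: leq_trans rk; rewrite ltnS ltnW // idx_gt1 //; lia.
have [i [j [[iQ jQ ij E] [oi oj]]]] := equal_idx_top_parts pQ wk k1 small.
have ri : (size Q - r < i)%N.
  by apply: (top_parts_last (w := w) pQ rQ iQ); rewrite oi.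
have rj : (size Q - r < j)%N.
  by apply: (top_parts_last (w := w) pQ rQ jQ); rewrite oj.
exists (size Q' - (size Q - i))%N, (size Q' - (size Q - j))%N.
split; try lia.
rewrite /idx -!same ?subKn //; lia.
Qed.

(** The cycle forces [kmax Q] to be the largest index. Two parts reach [kmax Q], and the index of
    each lies between [kmax Q] and the largest index. *)
Lemma top_cycle_multiplicity Q :
  Defs.indexed_partition Q -> top_cycle Q -> has_multiplicity Q.
Proof.
move=> pQ; have [[sQ _ _] fQ idx_mono] := pQ => -[_ [w _ <-] cyc].
have Q0 := size_partition_gt0 pQ.
have lastQ : (1 <= size Q <= size Q)%N by rewrite Q0 leqnn.
have ow : ostar_at Q (size Q) w = idx Q (size Q).
  exact: ostar_is_cycle (sQ _ lastQ) (fQ _ lastQ).1 cyc.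
have o_le v i : (1 <= i <= size Q)%N -> (ostar_at Q i v <= idx Q (size Q))%N.
  move=> iQ; apply: leq_trans (ostar_at_leq_idx pQ v iQ) _.
  by have [i0 iQ'] := andP iQ; apply: idx_mono.
have kE : kmax Q = idx Q (size Q).
  have [[v vk] kub] := kmaxP pQ; apply/eqP; rewrite eqn_leq; apply/andP; split.
    by rewrite -vk; have [i iQ <-] := omax_attained pQ v; apply: o_le.
  by rewrite -ow; exact: leq_trans (ostar_at_leq_omax _ lastQ) (kub w).
have wk : omax Q w = kmax Q.
  apply/eqP; rewrite eqn_leq (kmaxP pQ).2 kE -ow /=.
  exact: ostar_at_leq_omax.
have k1 : (1 < kmax Q)%N by rewrite kE idx_gt1.
have [i [j [iQ jQ ij oi oj]]] := two_top_parts pQ wk k1.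
have idx_top l : (1 <= l <= size Q)%N -> ostar_at Q l w = kmax Q ->
    idx Q l = idx Q (size Q).
  move=> /[dup] lQ /andP[l0 lQ'] ol; apply/eqP; rewrite eqn_leq idx_mono //=.
  by rewrite -kE -ol ostar_at_leq_idx.
by exists i, j; split; rewrite ?idx_top.
Qed.

Lemma top_cycle_same_last Q Q' : same_last 0 Q Q' -> top_cycle Q -> top_cycle Q'.
Proof.
move=> same; have := same 0%N (leqnn 0); rewrite !subn0 /top_cycle /idx.
by move=> ->.
Qed.

End Neighbours.

(** * From the metric to shared subgroups, and the three statements *)

Lemma dist_same_last (R : realType) (n r : nat) (Q Q' : coset_partition n) :
    (r < size (parts Q'))%N -> (dist R Q Q' < 2 ^- r.+1)%R ->
  (r < size (parts Q))%N /\ same_last r (parts Q') (parts Q).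
Proof.
move=> rQ' d.
have same j : (j <= r)%N ->
    onth (subgroup_tuple (parts Q)) j = onth (subgroup_tuple (parts Q')) j.
  move=> jr; apply: contrapT => ne; move: d; rewrite ltNge => /negP; apply.
  have tt' : subgroup_tuple (parts Q) != subgroup_tuple (parts Q').
    by apply/eqP => E; apply: ne; rewrite E.
  (* Position [j] is place [j.+1], so a difference there makes the distance at least [2 ^- j.+1]. *)
  have [_ _ /(_ j.+1 isT ne) dj] := first_diffP tt'.
  rewrite /dist (negPf tt') lef_pV2 ?posrE ?exprn_gt0 //.
  by rewrite ler_eXn2l ?ltr1n // (leq_trans dj).
(* [onth] gives [None] past the end, so agreement at position [r] bounds the length of [Q] from
   below. *)
have rQ : (r < size (parts Q))%N.
  have := congr1 isSome (same r (leqnn r)).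
  rewrite (onth_subgroup_tuple rQ') => /idP.
  by rewrite onthTE size_rev size_map.
split=> // j jr; apply: Some_inj.
by rewrite -!onth_subgroup_tuple ?same //; apply: leq_ltn_trans jr _.
Qed.

Unset Implicit Arguments.

Theorem theorem5 (R : realType) (n : nat) (hn : (2 <= n)%N)
    (P0 : partition_space R n) (Q0 : coset_partition n)
    (hQ0 : \pi_(partition_space R n) Q0 = P0) :
  (* (i) *)
  (top_cycle (parts Q0) ->
   forall (P : partition_space R n) (Q : coset_partition n),
     \pi_(partition_space R n) Q = P -> mdist P P0 < 1 / 2 ->
     top_cycle (parts Q) /\ has_multiplicity (parts Q)) /\
  (* (ii) *)
  (forall r : nat, kmax_condition r (parts Q0) ->
   forall (P : partition_space R n) (Q : coset_partition n),
     \pi_(partition_space R n) Q = P -> mdist P P0 < 2 ^- r.+1 ->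
     kmax_condition r (parts Q) /\ has_multiplicity (parts Q)) /\
  (* (iii) *)
  (forall r : nat, (2 <= r <= size (parts Q0) - 1)%N ->
   (exists u : free_group n,
     omax (parts Q0) u = kmax (parts Q0) /\
     let m := num_max (parts Q0) u in
     (2 <= m)%N /\
     ([/\ r = 3%N, (idx (parts Q0) (size (parts Q0) - 3) < kmax (parts Q0))%N,
          pmin (parts Q0) = 2%N & m = 2%N \/ (4 <= m)%N] \/
      [/\ (4 <= r)%N, (idx (parts Q0) (size (parts Q0) - r) < kmax (parts Q0))%N &
          [\/ (r <= pmin (parts Q0))%N, m = pmin (parts Q0) | (r.+1 <= m)%N]])) ->
   forall (P : partition_space R n) (Q : coset_partition n),
     \pi_(partition_space R n) Q = P -> mdist P P0 < 2 ^- r.+1 ->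
     has_multiplicity (parts Q)).
Proof.
rewrite -{P0}hQ0.
have partition_of (S : coset_partition n) : Defs.indexed_partition (parts S).
  by apply/asboolP; apply: (valP S).
have pQ0 := partition_of Q0.
have near r (Q : coset_partition n) : (r < size (parts Q0))%N ->
    mdist (\pi_(partition_space R n) Q) (\pi_(partition_space R n) Q0) < 2 ^- r.+1 ->
    (r < size (parts Q))%N /\ same_last r (parts Q0) (parts Q).
  move=> rQ0 d; apply: (@dist_same_last R) => //.
  by rewrite -rho_pi.
have lt_size r N : (2 <= r)%N -> (r <= N - 1)%N -> (r < N)%N by lia.
split; [|split].
(* The radius 1/2 is the case [r = 0]: only the last subgroup is shared. *)
- move=> top _ Q <-; rewrite div1r -[2^-1](exprN1 2) => d.
  have [_ same] := near 0%N Q (size_partition_gt0 pQ0) d.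
  have topQ := top_cycle_same_last same top.
  by split=> //; apply: top_cycle_multiplicity.
- move=> r [/andP[r2 rQ0'] cond] _ Q <- d.
  have rQ0 := lt_size _ _ r2 rQ0'.
  have [rQ same] := near r Q rQ0 d.
  have rk : (idx (parts Q0) (size (parts Q0) - r) < kmax (parts Q0))%N.
    by case: cond => [[-> //]|[-> //]].
  have kE := kmax_same_last pQ0 (partition_of Q) rQ0 rQ same rk.
  split.
    split; first by rewrite r2 /= leq_subRL ?add1n // (leq_ltn_trans _ rQ).
    case: cond => [[rE k2]|[rE k3 p3]]; [left|right]; split; rewrite /pmin ?kE //;
      by rewrite /idx -same // rE.
  have [[w wk] _] := kmaxP pQ0.
  apply: (multiplicity_same_last pQ0 rQ0 rQ same rk wk).
  (* It remains that [r <= pmin]: for [r = 2] because [pmin] is prime, for [r = 3] by assumption. *)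
  apply: leq_trans (num_max_leq pQ0 w rQ0 rk) _.
  case: cond => [[-> k2]|[-> //]]; rewrite prime_gt1 // pdiv_prime //.
  by apply: leq_trans k2; rewrite ltnS ltnW // idx_gt1 //; lia.
- move=> r /andP[r2 rQ0'] [u [uk [_ cond]]] _ Q <- d.
  have rQ0 := lt_size _ _ r2 rQ0'.
  have [rQ same] := near r Q rQ0 d.
  have rk : (idx (parts Q0) (size (parts Q0) - r) < kmax (parts Q0))%N.
    by case: cond => [[-> //]|[_ //]].
  have mr := num_max_leq pQ0 u rQ0 rk.
  (* Each alternative must give [num_max <= pmin]; those with [num_max] above [r] contradict
     [mr]. *)
  apply: (multiplicity_same_last pQ0 rQ0 rQ same rk uk).
  case: cond => [[rE _ -> m24]|[_ _ [rp|-> //|rm]]]; last 2 first.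
  + exact: leq_trans mr rp.
  + by rewrite ltnNge mr in rm.
  by case: m24 => [-> //|m4]; move: mr; rewrite rE leqNgt m4.
Qed.
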